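(* $\lim_{n \to \infty} c(L_{2,n}) = \alpha\sqrt{2} \approx 1.6437$, where $\alpha$ is the largest real solution to $x = \tan\left(\frac{1}{x}\right)$.
   Context: For a positive integer $h$ and a finite simple graph $G$ with $n$ vertices and $k$ connected components, fix one vertex in each connected component of $G$, and let $\mathrm{Lip}(G;h)$ be the set of functions $f: V(G) \to \mathbb{Z}$ such that $f$ takes the value $0$ at each of the fixed vertices and $|f(x)-f(y)| \le h$ for every edge $\{x,y\} \in E(G)$. The cardinality $|\mathrm{Lip}(G;h)|$ does not depend on the choice of fixed vertices. If $k < n$, define $c(G) = \lim_{h\to\infty} \frac{1}{h}\,|\mathrm{Lip}(G;h)|^{1/(n-k)}$ (limit over positive integers $h$; this limit exists). $L_{m,n}$ denotes the $m \times n$ grid graph, i.e. the graph Cartesian product of a path on $m$ vertices and a path on $n$ vertices. *)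

(* Defs.v *)
From HB Require Import structures.
From mathcomp Require Import all_boot all_order all_algebra finmap.
From mathcomp Require Import all_classical all_reals all_analysis.

Set Implicit Arguments.
Unset Strict Implicit.
Unset Printing Implicit Defensive.

Import Order.TTheory GRing.Theory Num.Theory.
Import numFieldNormedType.Exports.

Local Open Scope ring_scope.

Record sgraph := SGraph {
  vertex :> finType;
  adj : rel vertex;
  adj_sym : symmetric adj;
  adj_irr : irreflexive adj }.

Definition components (G : sgraph) : {set {set G}} :=
  equivalence_partition (connect (@adj G)) (finset.setTfor G).

(* S meets every connected component in exactly one vertex. *)
Definition basepoints (G : sgraph) (S : {set G}) : bool :=
  is_transversal S (components G) (finset.setTfor G).

Definition Lip (G : sgraph) (S : {set G}) (h : nat) : set {ffun G -> int} :=
  [set f | (forall r, r \in S -> f r = 0) /\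
           (forall x y, adj x y -> `|f x - f y| <= h%:Z)]%classic.

(* fset_set returns the empty set on infinite sets; the next result shows that
   this default value is not reached in the definition of c. *)
Lemma finite_Lip (G : sgraph) (S : {set G}) (h : nat) :
  basepoints S -> finite_set (Lip S h).
Proof.
move=> /and3P[_ _ /forall_inP trS].
pose B := (h * #|G|)%N.
have bnd f x : Lip S h f -> `|f x| <= B%:Z.
  move=> [f0 fL].
  have Cx : [set y in [set: G]%SET | connect (@adj G) x y]%SET \in components G.
    by apply/imsetP; exists x; rewrite ?finset.in_setT.
  have /cards1P[r /setP/(_ r)] := trS _ Cx.
  rewrite !finset.inE eqxx /= => /andP[rS /connectP[p pth lastp]].
  case/shortenP: pth lastp => q pth uq _ lastq.
  have szq : (size q <= #|G|)%N.
    by apply: leq_trans (leqnSn _) _; rewrite -[X in (X <= _)%N]/(size (x :: q)) -(card_uniqP uq) max_card.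
  have step z s : path (@adj G) z s -> `|f z - f (last z s)| <= (h * size s)%N%:Z.
    elim: s z => [|y s IH] z /=; first by rewrite subrr normr0 muln0.
    move=> /andP[/fL zy /IH ys]; rewrite -(subrKA (f y)) mulnS PoszD.
    exact: le_trans (ler_normD _ _) (lerD zy ys).
  have := step _ _ pth; rewrite -lastq (f0 _ rS) subr0 => /le_trans; apply.
  by rewrite lez_nat leq_mul2l szq orbT.
pose g (u : {ffun G -> 'I_(B + B).+1}) : {ffun G -> int} :=
  [ffun x => (u x : nat)%:Z - B%:Z].
apply: (@sub_finite_set _ _ (g @` setT)%classic).
  move=> f Lf; exists [ffun x => inord (absz (f x + B%:Z)%R)] => //.
  apply/ffunP => x; rewrite !ffunE inordK.
    rewrite gez0_abs ?addrK //.
    by have := bnd f x Lf; rewrite ler_norml => /andP[+ _]; rewrite -subr_ge0 opprK.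
  rewrite ltnS -lez_nat abszE PoszD; apply: le_trans (ler_normD _ _) _.
  by rewrite lerD ?bnd.
exact/finite_image/finite_finset.
Qed.

(* The exponent and the limit are meaningful when #|components G| < #|G|. *)
Definition c (R : realType) (G : sgraph) (S : {set G}) : R :=
  lim ((fun h : nat =>
          (h%:R)^-1 * (#|` fset_set (Lip S h)|%fset)%:R
             `^ ((#|G| - #|components G|)%N%:R)^-1 : R) @ \oo)%classic.

Section Path.
Variable n : nat.
Definition path_adj : rel 'I_n := fun i j => (i.+1 == j)%N || (j.+1 == i)%N.
Fact path_adj_sym : symmetric path_adj.
Proof. by move=> i j; rewrite /path_adj orbC. Qed.
Fact path_adj_irr : irreflexive path_adj.
Proof. by move=> i; rewrite /path_adj orbb gtn_eqF. Qed.
Definition path_graph : sgraph := SGraph path_adj_sym path_adj_irr.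
End Path.

Section CartesianProduct.
Variables G H : sgraph.
Definition cart_adj : rel (G * H)%type := fun u v =>
  (u.1 == v.1) && adj u.2 v.2 || adj u.1 v.1 && (u.2 == v.2).
Fact cart_adj_sym : symmetric cart_adj.
Proof.
move=> u v; rewrite /cart_adj (eq_sym u.1) (eq_sym u.2).
by rewrite (adj_sym u.1) (adj_sym u.2).
Qed.
Fact cart_adj_irr : irreflexive cart_adj.
Proof. by move=> u; rewrite /cart_adj !adj_irr andbF. Qed.
Definition cart : sgraph := SGraph cart_adj_sym cart_adj_irr.
End CartesianProduct.

Definition grid (m n : nat) : sgraph := cart (path_graph m) (path_graph n).

(* Inverse and tan are total with 0^-1 = 0 and tan y = 0 when cos y = 0, so the
   points where tan (1/x) is undefined are excluded explicitly. *)
Definition tan_inv_solution (R : realType) (x : R) : Prop :=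
  [/\ x != 0, cos x^-1 != 0 & x = tan x^-1].

Definition largest_tan_inv_solution (R : realType) (a : R) : Prop :=
  tan_inv_solution a /\ forall x : R, tan_inv_solution x -> x <= a.

(* Main.v *)
(* Writing d_i for the difference across the i-th rung, a Lipschitz function on
   the ladder is counted by the transfer kernel K(d, e) = 2h + 1 - |d - e| on
   [-h, h]. The second difference of K is -2 times a Dirac mass, so cos(t d)
   satisfies the eigenvalue equation for 1 / (1 - cos t) up to an additive
   constant, whose sign is that of h cos(t h) - (h + 1) cos(t (h + 1)). If w is
   the root of cos w = w sin w in (0, 1), this sign is nonnegative for t = w / h
   and nonpositive for t = w / (h + 1), so the cosine is a sub-, respectively
   supersolution, and |Lip(h)| is bounded on both sides by constant multiples
   of h^(2n-1) (2 / w^2)^(n-1), uniformly for h >= n. The limit in h exists and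
   is an infimum because f |-> (f div k, f mod k) gives
   |Lip(kh)| <= k^(#V - #components) |Lip(h)|. *)
Require Import Defs.
From HB Require Import structures.
From mathcomp Require Import all_boot all_order all_algebra finmap.
From mathcomp Require Import all_classical all_reals all_analysis.
From mathcomp Require Import ring lra zify.
Import Order.TTheory GRing.Theory Num.Theory.
Import numFieldNormedType.Exports.
Local Open Scope classical_set_scope.
Local Open Scope ring_scope.

(** * Taylor bounds for sine and cosine, and the constant alpha *)

Lemma ge0_of_derive_ge0 (R : realType) (f f' : R -> R) :
  f 0 = 0 -> (forall x : R^o, is_derive x (1 : R^o) (f : R^o -> R^o) (f' x)) ->
  (forall x, 0 <= x -> 0 <= f' x) -> forall x, 0 <= x -> 0 <= f x.
Proof.
move=> f0 df f'0 x x0; rewrite -f0.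
apply: (@ger0_derive1_ndecry _ f 0) => //.
  move=> y; rewrite in_itv/= andbT => y0.
  by rewrite derive1E derive_val f'0 // ltW.
apply: continuous_subspaceT => y.
by apply/differentiable_continuous/derivable1_diffP; case: (df y).
Qed.

(* Locked: unifying numerals such as 10! up to conversion computes in unary. *)
HB.lock Definition rfact (R : realType) (k : nat) : R := k`!%:R.

Lemma rfact0 (R : realType) : rfact R 0 = 1.
Proof. by rewrite unlock fact0. Qed.

Lemma rfactS (R : realType) (k : nat) : rfact R k.+1 = k.+1%:R * rfact R k.
Proof. by rewrite unlock factS natrM. Qed.

Lemma rfact_neq0 (R : realType) (k : nat) : rfact R k != 0.
Proof. by rewrite unlock pnatr_eq0 -lt0n fact_gt0. Qed.

Definition cos_poly (R : realType) (k : nat) : {poly R} :=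
  \sum_(i < k) ((-1) ^+ i / rfact R i.*2) *: 'X^(i.*2).

Definition sin_poly (R : realType) (k : nat) : {poly R} :=
  \sum_(i < k) ((-1) ^+ i / rfact R i.*2.+1) *: 'X^(i.*2.+1).

Lemma deriv_sin_poly (R : realType) (k : nat) :
  (sin_poly R k)^`() = cos_poly R k.
Proof.
rewrite linear_sum; apply: eq_bigr => i _.
rewrite /= derivZ derivXn -['X^_ *+ _]scaler_nat scalerA; congr (_ *: _).
rewrite rfactS /=; field.
by rewrite nat1r pnatr_eq0 rfact_neq0.
Qed.

Lemma deriv_cos_poly (R : realType) (k : nat) :
  (cos_poly R k.+1)^`() = - sin_poly R k.
Proof.
rewrite /cos_poly big_ord_recl derivD /= expr0 derivZ derivXn mulr0n scaler0 add0r.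
rewrite linear_sum -sumrN; apply: eq_bigr => i _.
rewrite /= derivZ derivXn /= /bump /= add1n doubleS.
rewrite -['X^_ *+ _]scaler_nat scalerA -scaleNr.
congr (_ *: _).
rewrite (rfactS _ i.*2.+1) exprS; field.
by rewrite -natrD pnatr_eq0 rfact_neq0.
Qed.

(** Partial Taylor sums lie alternately above and below the function. Starting from [cos y <= 1],
    integration from 0 carries each cosine bound to a sine bound, and that one to the next cosine
    bound with the sign reversed. *)
Lemma sin_cos_alternate (R : realType) (k : nat) (x : R) : 0 <= x ->
  0 <= (-1) ^+ k.+1 * (cos x - (cos_poly R k.+1).[x]) /\
  0 <= (-1) ^+ k.+1 * (sin x - (sin_poly R k.+1).[x]).
Proof.
have sinstep j : (forall y : R, 0 <= y ->
      0 <= (-1) ^+ j.+1 * (cos y - (cos_poly R j.+1).[y])) ->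
    forall y : R, 0 <= y ->
      0 <= (-1) ^+ j.+1 * (sin y - (sin_poly R j.+1).[y]).
  move=> H; apply: (@ge0_of_derive_ge0 R _
    (fun y => (-1) ^+ j.+1 * (cos y - (cos_poly R j.+1).[y]))) => //.
    rewrite sin0 /sin_poly horner_sum big1 ?subrr ?mulr0 // => i _.
    by rewrite !hornerE /= expr0n mulr0.
  move=> y; apply: is_deriveZ; apply: is_deriveB.
  by rewrite -deriv_sin_poly; exact: is_derive_poly.
elim: k x => [|k IH] x x0.
  have c1 y : 0 <= y -> 0 <= (-1) ^+ 1 * (cos y - (cos_poly R 1).[y]).
    move=> _; rewrite /cos_poly big_ord_recl big_ord0 addr0 /= !hornerE /=.
    by rewrite double0 rfact0 invr1; have := cos_le1 y; lra.
  by split; [exact: c1|exact: sinstep].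
have ck : forall y : R, 0 <= y -> 0 <= (-1) ^+ k.+2 * (cos y - (cos_poly R k.+2).[y]).
  apply: (@ge0_of_derive_ge0 R _
    (fun y => (-1) ^+ k.+2 * (- sin y - (- (sin_poly R k.+1).[y])))).
  - rewrite cos0 /cos_poly horner_sum big_ord_recl big1 => [|i _].
      by rewrite !hornerE /= double0 rfact0; field.
    by rewrite !hornerE /= mulr0 mul0r.
  - move=> z; apply: is_deriveZ; apply: is_deriveB.
    by rewrite -hornerN -deriv_cos_poly; exact: is_derive_poly.
  - by move=> z /IH[_]; rewrite [(-1) ^+ k.+2]exprS; lra.
by split; [exact: ck|exact: sinstep].
Qed.

Lemma horner_cos_poly0 (R : realType) (x : R) : (cos_poly R 0).[x] = 0.
Proof. by rewrite /cos_poly big_ord0 horner0. Qed.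

Lemma horner_cos_polyS (R : realType) (k : nat) (x : R) :
  (cos_poly R k.+1).[x] =
  (cos_poly R k).[x] + (-1) ^+ k * x ^+ k.*2 / rfact R k.*2.
Proof.
by rewrite /cos_poly big_ord_recr hornerD hornerZ hornerXn mulrAC.
Qed.

Lemma horner_sin_poly0 (R : realType) (x : R) : (sin_poly R 0).[x] = 0.
Proof. by rewrite /sin_poly big_ord0 horner0. Qed.

Lemma horner_sin_polyS (R : realType) (k : nat) (x : R) :
  (sin_poly R k.+1).[x] =
  (sin_poly R k).[x] + (-1) ^+ k * x ^+ k.*2.+1 / rfact R k.*2.+1.
Proof.
by rewrite /sin_poly big_ord_recr hornerD hornerZ hornerXn mulrAC.
Qed.

Definition taylorE := (horner_cos_poly0, horner_cos_polyS, horner_sin_poly0,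
  horner_sin_polyS, doubleS, double0, rfactS, rfact0).

Lemma cos_ge_taylor2 (R : realType) (x : R) : 0 <= x -> 1 - x ^+ 2 / 2 <= cos x.
Proof.
move=> /(sin_cos_alternate _ 1)[+ _].
rewrite !taylorE.
lra.
Qed.

Lemma cos_le_taylor4 (R : realType) (x : R) : 0 <= x ->
  cos x <= 1 - x ^+ 2 / 2 + x ^+ 4 / 24.
Proof.
move=> /(sin_cos_alternate _ 2)[+ _].
rewrite !taylorE.
lra.
Qed.

Lemma sin_le_id (R : realType) (x : R) : 0 <= x -> sin x <= x.
Proof.
move=> /(sin_cos_alternate _ 0)[_].
rewrite !taylorE.
lra.
Qed.

Lemma sin_ge_taylor3 (R : realType) (x : R) : 0 <= x -> x - x ^+ 3 / 6 <= sin x.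
Proof.
move=> /(sin_cos_alternate _ 1)[_].
rewrite !taylorE.
lra.
Qed.

Lemma mul_cos_le_sin (R : realType) (x : R) : 0 <= x <= 1 -> x * cos x <= sin x.
Proof.
move=> /andP[x0 x1].
have := cos_le_taylor4 _ _ x0; have := sin_ge_taylor3 _ _ x0.
have x2 : x ^+ 2 <= 1 by rewrite expr_le1.
nra.
Qed.

(** [1503 / 1747] and [154 / 179] enclose the root [w] of [cos w = w * sin w] closely enough to fix
    the decimals of [sqrt 2 / w]. The left end is the delicate one, because [sqrt 2 / w] is about
    1.643797, just under 1.6438. *)
Lemma cos_gt_id_sin (R : realType) :
  (1503 / 1747 : R) * sin (1503 / 1747) < cos (1503 / 1747).
Proof.
have [t tE] : {t : R | t = 1503 / 1747} by exists (1503 / 1747).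
have t0 : 0 <= t by rewrite tE; lra.
rewrite -tE.
(* Cosine from below to degree 10, sine from above to degree 9. The value of [t] is put in only
   after the expansion. *)
have [+ _] := sin_cos_alternate _ 5 _ t0; have [_] := sin_cos_alternate _ 4 _ t0.
rewrite !taylorE tE.
lra.
Qed.

Lemma cos_lt_id_sin (R : realType) :
  cos (154 / 179 : R) < (154 / 179) * sin (154 / 179).
Proof.
have [t tE] : {t : R | t = 154 / 179} by exists (154 / 179).
have t0 : 0 <= t by rewrite tE; lra.
rewrite -tE.
have [+ _] := sin_cos_alternate _ 4 _ t0; have [_] := sin_cos_alternate _ 3 _ t0.
rewrite !taylorE tE.
lra.
Qed.

Lemma exists_cos_eq_id_sin (R : realType) :
  exists w : R, [/\ 1503 / 1747 <= w <= 154 / 179 & cos w = w * sin w].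
Proof.
have ab : 1503 / 1747 <= 154 / 179 :> R by lra.
have cf : {within `[1503 / 1747, 154 / 179 : R],
    continuous (fun x : R => cos x - x * sin x)}.
  apply: continuous_subspaceT => x.
  apply: cvgB; first exact: continuous_cos.
  by apply: cvgM; [exact: cvg_id|exact: continuous_sin].
have [|w] := @IVT R _ _ _ 0 ab cf.
  rewrite ge_min le_max !subr_le0 !subr_ge0.
  by rewrite (ltW (cos_gt_id_sin R)) (ltW (cos_lt_id_sin R)) orbT.
rewrite in_itv /= => wI /eqP; rewrite subr_eq0 => /eqP wE.
by exists w.
Qed.

Lemma cos_gt0_of_le1 (R : realType) (x : R) : 0 <= x <= 1 -> 0 < cos x.
Proof.
move=> /andP[x0 x1]; apply: lt_le_trans (cos_ge_taylor2 _ _ x0); nra.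
Qed.

(** With [t = x^-1] the equation becomes [cos t = t * sin t], and a larger [x] means a smaller [t].
    Below [w] the left side is larger than at [w] and the right side smaller, so no positive root
    precedes [w]. *)
Lemma largest_tan_inv_solution_inv (R : realType) (w : R) : 0 < w <= 1 ->
  cos w = w * sin w -> largest_tan_inv_solution w^-1.
Proof.
move=> /andP[w0 w1] wE.
have pi2 := pi_ge2 R.
have cw : 0 < cos w by apply: cos_gt0_of_le1; rewrite ltW.
split.
  split; rewrite ?invrK ?invr_eq0 ?gt_eqF //.
  have sw : sin w != 0.
    by apply: contraTneq cw => s0; rewrite wE s0 mulr0 ltxx.
  by rewrite /tan wE; field; rewrite sw gt_eqF.
move=> x [xn0 cx xE]; rewrite leNgt; apply/negP => wx.
have x0 : 0 < x by apply: lt_trans wx; rewrite invr_gt0.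
set t := x^-1 in cx xE.
have t0 : 0 < t by rewrite invr_gt0.
have tw : t < w by rewrite -[w]invrK ltf_pV2 // posrE invr_gt0.
have tE : cos t = t * sin t.
  move: xE; rewrite /tan => /(congr1 (fun z => t * cos t * z)).
  by rewrite /t mulrAC mulVf // mul1r => ->; field; rewrite xn0 cx.
have ct : cos w < cos t by rewrite ltr_cos // in_itv /=; lra.
have st : sin t < sin w by rewrite ltr_sin // in_itv /=; lra.
have sw : 0 < sin w.
  by move: cw; rewrite wE pmulr_rgt0.
have := ltr_pM2l t0 (sin t) (sin w); have := ltr_pM2r sw t w.
by rewrite st tw => h1 h2; move: ct; rewrite wE tE; lra.
Qed.

Lemma inv_mul_sqrt2_bounds (R : realType) (w : R) :
  1503 / 1747 <= w <= 154 / 179 ->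
  16437 / 10 ^+ 4 <= w^-1 * Num.sqrt 2 < 16438 / 10 ^+ 4.
Proof.
move=> wb; have w0 : 0 < w by lra.
have s0 : 0 <= Num.sqrt 2 :> R := sqrtr_ge0 _.
have s2 : Num.sqrt 2 ^+ 2 = 2 :> R by rewrite sqr_sqrtr.
move: s0 s2; set s := Num.sqrt 2 => s0 s2.
rewrite [_ * s]mulrC ler_pdivlMr // ltr_pdivrMr //.
apply/andP; split; [rewrite leNgt|rewrite ltNge]; apply/negP => H; nra.
Qed.

(** * Lipschitz functions on the ladder as paths of rungs *)

Definition ball_seq (h : nat) : seq int :=
  [seq i%:Z - h%:Z | i <- iota 0 (2 * h).+1].

Lemma mem_ball_seq (h : nat) (x : int) : (x \in ball_seq h) = (`|x| <= h%:Z).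
Proof.
apply/mapP/idP => [[i]|xh]; first by rewrite mem_iota => ih ->; lia.
by exists (absz (x + h%:Z)); rewrite ?mem_iota; lia.
Qed.

Lemma uniq_ball_seq (h : nat) : uniq (ball_seq h).
Proof. by rewrite map_inj_uniq ?iota_uniq // => i j; lia. Qed.

Lemma size_ball_seq (h : nat) : size (ball_seq h) = (2 * h).+1.
Proof. by rewrite size_map size_iota. Qed.

Lemma count_iota_itv (a b m : nat) :
  count (fun i => (a <= i < b)%N) (iota 0 m) = (minn b m - a)%N.
Proof.
elim: m => [|m IH]; first by rewrite minn0.
by rewrite -addn1 iotaD count_cat IH /= add0n; lia.
Qed.

(** This is the overlap of two integer intervals with [2h + 1] points each, shifted by [x]; the
    bound on [x] keeps them from being disjoint. It produces the entries of the transfer kernel. *)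
Lemma count_shift_ball_seq (h : nat) (x : int) : `|x| <= (2 * h)%:Z ->
  (count (fun s => `|x + s| <= h%:Z) (ball_seq h))%:Z = (2 * h).+1%:Z - `|x|.
Proof.
move=> xh; rewrite count_map.
have [x0|x0] := leP 0 x.
  rewrite (@eq_count _ _ (fun i => 0 <= i < absz ((2 * h).+1%:Z - x))%N).
    by rewrite count_iota_itv; lia.
  by move=> i /=; lia.
rewrite (@eq_count _ _ (fun i => absz x <= i < absz ((2 * h).+1%:Z - x))%N).
  by rewrite count_iota_itv; lia.
by move=> i /=; lia.
Qed.

(* A Lipschitz function on the ladder is read as the list of its values on the
   rungs; rungs p and q may follow each other when ladder_step h p q. *)
Definition ladder_step (h : nat) : rel (int * int) := fun p q =>
  [&& `|p.1 - q.1| <= h%:Z, `|p.2 - q.2| <= h%:Z & `|q.1 - q.2| <= h%:Z].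

(** The next rung is parametrised by its difference [d] and the step [s] along the first side; the
    filter bounds the step along the second side. With [d] outermost, the choices of [s] can be
    counted for each [d] separately. *)
Definition ladder_next (h : nat) (p : int * int) : seq (int * int) :=
  [seq (p.1 + s, p.1 + s - d) | d <- ball_seq h,
     s <- [seq s <- ball_seq h | `|p.1 - p.2 - d + s| <= h%:Z]].

Lemma mem_ladder_next (h : nat) (p q : int * int) :
  (q \in ladder_next h p) = ladder_step h p q.
Proof.
apply/allpairsPdep/and3P => [[d [s []]]|[pq1 pq2 q12]].
  by rewrite mem_filter !mem_ball_seq => dh /andP[ps sh] -> /=; split; lia.
exists (q.1 - q.2), (q.1 - p.1); rewrite mem_filter !mem_ball_seq; split=> //.
- by apply/andP; split; lia.
- by case: q {pq1 pq2 q12} => a b /=; congr pair; lia.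
Qed.

Lemma uniq_ladder_next (h : nat) (p : int * int) : uniq (ladder_next h p).
Proof.
apply: allpairs_uniq_dep; first exact: uniq_ball_seq.
  by move=> d _; rewrite filter_uniq ?uniq_ball_seq.
move=> [d s] [d' s'] _ _ /= [e1 e2]; have <- : d = d' by lia.
by congr Tagged; lia.
Qed.

Fixpoint ladder_paths (h n : nat) (p : int * int) : seq (seq (int * int)) :=
  if n is m.+1 then [seq q :: l | q <- ladder_next h p, l <- ladder_paths h m q]
  else [:: [::]].

Lemma mem_ladder_paths (h n : nat) (p : int * int) (l : seq (int * int)) :
  (l \in ladder_paths h n p) = (size l == n) && path (ladder_step h) p l.
Proof.
elim: n p l => [|n IH] p l /=; first by rewrite inE; case: l.
apply/allpairsPdep/andP => [[q [l' [qp + ->]]]|[]].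
  by rewrite IH => /andP[/eqP <- pl] /=; rewrite eqxx -mem_ladder_next qp.
case: l => [//|q l] /=; rewrite eqSS => sl /andP[pq ql].
by exists q, l; rewrite mem_ladder_next IH sl pq ql.
Qed.

Lemma uniq_ladder_paths (h n : nat) (p : int * int) : uniq (ladder_paths h n p).
Proof.
elim: n p => [//|n IH] p /=.
apply: allpairs_uniq_dep; first exact: uniq_ladder_next.
  by move=> q _; exact: IH.
by move=> [q l] [q' l'] _ _ /= [-> ->].
Qed.

(* The transfer operator of the ladder, acting on functions of the difference
   across a rung. *)
Definition transfer (R : pzRingType) (h : nat) (v : int -> R) (d : int) : R :=
  \sum_(e <- ball_seq h) ((2 * h).+1%:Z - `|d - e|)%:~R * v e.

Lemma sum_ladder_next (R : pzRingType) (h : nat) (v : int -> R)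
    (p : int * int) : `|p.1 - p.2| <= h%:Z ->
  \sum_(q <- ladder_next h p) v (q.1 - q.2) = transfer _ h v (p.1 - p.2).
Proof.
move=> ph; rewrite big_allpairs_dep; apply: eq_big_seq => d.
rewrite mem_ball_seq => dh.
rewrite (eq_bigr (fun=> v d)) => [|s _]; last by rewrite /= opprB addrC subrK.
rewrite big_const_seq count_predT size_filter iter_addr_0 -count_shift_ball_seq.
  by rewrite mulr_natl.
by lia.
Qed.

Lemma size_ladder_pathsS (R : pzSemiRingType) (h n : nat) (p : int * int) :
  (size (ladder_paths h n.+1 p))%:R =
  \sum_(q <- ladder_next h p) (size (ladder_paths h n q))%:R :> R.
Proof.
by rewrite /= size_allpairs_dep sumnE big_map natr_sum.
Qed.

(** Comparison principle: path counts arise by iterating the transfer operator from the constant 1,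
    and its kernel is nonnegative on the ball, so a supersolution that starts above [c0] stays above
    the rescaled counts. The next lemma is the mirror image for subsolutions. *)
Lemma size_ladder_paths_le (R : realFieldType) (h n : nat) (v : int -> R)
    (mu c0 : R) (p : int * int) : 0 <= mu ->
  (forall d, `|d| <= h%:Z -> c0 <= v d) ->
  (forall d, `|d| <= h%:Z -> mu * transfer _ h v d <= v d) ->
  `|p.1 - p.2| <= h%:Z ->
  c0 * mu ^+ n * (size (ladder_paths h n p))%:R <= v (p.1 - p.2).
Proof.
move=> mu0 vc vT; elim: n p => [|n IH] p ph; first by rewrite expr0 !mulr1 vc.
apply: le_trans (vT _ ph); rewrite size_ladder_pathsS -sum_ladder_next //.
rewrite exprS mulrCA -mulrA ler_wpM2l // mulr_sumr big_seq [leRHS]big_seq.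
by apply: ler_sum => q; rewrite mem_ladder_next => /and3P[_ _]; exact: IH.
Qed.

Lemma size_ladder_paths_ge (R : realFieldType) (h n : nat) (v : int -> R)
    (mu : R) (p : int * int) : 0 <= mu ->
  (forall d, `|d| <= h%:Z -> v d <= 1) ->
  (forall d, `|d| <= h%:Z -> v d <= mu * transfer _ h v d) ->
  `|p.1 - p.2| <= h%:Z ->
  v (p.1 - p.2) <= mu ^+ n * (size (ladder_paths h n p))%:R.
Proof.
move=> mu0 v1 vT; elim: n p => [|n IH] p ph; first by rewrite expr0 !mulr1 v1.
apply: le_trans (vT _ ph) _; rewrite size_ladder_pathsS -sum_ladder_next //.
rewrite exprS -mulrA ler_wpM2l // mulr_sumr big_seq [leRHS]big_seq.
by apply: ler_sum => q; rewrite mem_ladder_next => /and3P[_ _]; exact: IH.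
Qed.

(* Green's identity for the discrete Laplacian on [0, m). *)
Lemma discrete_green (R : comPzRingType) (m : nat) (a b : int -> R) :
  \sum_(i < m) (b i%:Z * (2 * a i%:Z - a (i%:Z + 1) - a (i%:Z - 1)) -
                a i%:Z * (2 * b i%:Z - b (i%:Z + 1) - b (i%:Z - 1))) =
  b (-1) * a 0 - b 0 * a (-1) + b m%:Z * a (m%:Z - 1) - b (m%:Z - 1) * a m%:Z.
Proof.
elim: m => [|m IH]; first by rewrite big_ord0 sub0r; ring.
rewrite big_ord_recr /= IH.
have -> : m.+1%:Z = m%:Z + 1 by lia.
rewrite addrK; ring.
Qed.

(** * The cosine profile *)

Lemma transfer_cos (R : realType) (h : nat) (t : R) (d : int) :
  `|d| <= h%:Z ->
  (1 - cos t) * transfer R h (fun e => cos (t * e%:~R)) d =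
  cos (t * d%:~R) + (h%:R * cos (t * h%:R) - h.+1%:R * cos (t * h.+1%:R)).
Proof.
move=> dh.
(* Indices are shifted by [h] so that the ball becomes [[0, 2h]]. Green's identity is applied to the
   cosine [a] and the kernel row [b], which is not truncated outside the ball, so its second
   difference lives only at the kink. *)
pose a (i : int) : R := cos (t * (i - h%:Z)%:~R).
pose b (i : int) : R := ((2 * h).+1%:Z - `|d - (i - h%:Z)|)%:~R.
have lapa i : 2 * a i - a (i + 1) - a (i - 1) = 2 * (1 - cos t) * a i.
  rewrite /a (_ : i + 1 - h%:Z = (i - h%:Z) + 1); last by lia.
  rewrite (_ : i - 1 - h%:Z = (i - h%:Z) - 1); last by lia.
  move: (i - h%:Z) => k; rewrite rmorphD rmorphB rmorph1 mulrDr mulrBr mulr1.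
  by rewrite cosD cosB; ring.
have lapb i : 2 * b i - b (i + 1) - b (i - 1) = (2 * (i == d + h%:Z)%:Z)%:~R.
  rewrite /b -[2]/(2%:~R) -intrM -!intrB; congr (_%:~R).
  by have [->|ne] := eqVneq i (d + h%:Z); lia.
have dlt : (absz (d + h%:Z)%R < (2 * h).+1)%N by lia.
have := @discrete_green R (2 * h).+1 a b.
under eq_bigr do rewrite lapa lapb.
rewrite sumrB [X in _ - X](bigD1 (Ordinal dlt)) //=.
rewrite [X in a _ * _ + X]big1 => [|i]; last first.
  rewrite -val_eqE /= => ne; rewrite (_ : _ == _ = false) ?mulr0 //.
  by apply/negP => /eqP E; move: ne; rewrite -E eqxx.
have -> : `|(d + h%:Z)%R|%N%:Z = d + h%:Z by lia.
rewrite eqxx mulr1 addr0.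
have -> : \sum_(i < (2 * h).+1) b i%:Z * (2 * (1 - cos t) * a i%:Z) =
    2 * ((1 - cos t) * transfer R h (fun e => cos (t * e%:~R)) d).
  rewrite /transfer big_map -[X in iota _ X]subn0 -/(index_iota _ _) big_mkord.
  by rewrite !mulr_sumr; apply: eq_bigr => i _; rewrite /a /b; ring.
have aE : [/\ a (-1) = cos (t * h.+1%:R), a 0 = cos (t * h%:R),
    a ((2 * h).+1%:Z - 1) = cos (t * h%:R) &
    a (2 * h).+1%:Z = cos (t * h.+1%:R)].
  rewrite /a (_ : -1 - h%:Z = - h.+1%:Z); last by lia.
  rewrite (_ : 0 - h%:Z = - h%:Z); last by lia.
  rewrite (_ : (2 * h).+1%:Z - 1 - h%:Z = h%:Z); last by lia.
  rewrite (_ : (2 * h).+1%:Z - h%:Z = h.+1%:Z); last by lia.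
  by rewrite !mulrNz !mulrN !cosN.
have [-> -> -> ->] := aE.
have adE : a (d + h%:Z) = cos (t * d%:~R) by rewrite /a addrK.
(* The terms in [d] have opposite signs at the two ends and the cosine is even, so they cancel: the
   boundary contribution is constant in [d]. *)
have bE : [/\ b (-1) = h%:R - d%:~R, b 0 = h.+1%:R - d%:~R,
    b (2 * h).+1%:Z = h%:R + d%:~R &
    b ((2 * h).+1%:Z - 1) = h.+1%:R + d%:~R].
  split; rewrite /b -![_%:R]/(_%:Z%:~R) -?intrB -?intrD; congr (_%:~R); lia.
have [-> -> -> ->] := bE; rewrite adE; lra.
Qed.

(** For [t = w / h], the addition formula and [sin w = cos w / w] let [cos w] be factored out,
    leaving [(h + 1) (cos t - sin t / w) <= h]. Here [t cos t <= sin t] gives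
    [sin t / w >= cos t / h]. *)
Lemma cos_profile_ge (R : realType) (w : R) (h : nat) : 0 < w <= 1 ->
  cos w = w * sin w -> (0 < h)%N ->
  h.+1%:R * cos (w / h%:R * h.+1%:R) <= h%:R * cos (w / h%:R * h%:R).
Proof.
move=> /andP[w0 w1] wE h0.
have h1 : 1 <= h%:R :> R by rewrite ler1n.
have cw : 0 < cos w by apply: cos_gt0_of_le1; rewrite ltW.
set t := w / h%:R; have tw : t * h%:R = w by rewrite /t divfK // gt_eqF; lra.
have t0 : 0 < t by rewrite divr_gt0 //; lra.
have t1 : t <= 1 by rewrite ler_pdivrMr; lra.
have ts : t * cos t <= sin t by apply: mul_cos_le_sin; rewrite ltW.
have sw : sin w = cos w / w by rewrite wE; field; rewrite gt_eqF.
rewrite -natr1 mulrDr mulr1 tw cosD sw.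
rewrite (_ : cos w * cos t - _ = cos w * (cos t - sin t / w)); last by ring.
rewrite mulrCA [leRHS]mulrC ler_pM2l //.
have : cos t / h%:R <= sin t / w.
  rewrite -tw invfM mulrA ler_wpM2r ?invr_ge0 //.
  by rewrite ler_pdivlMr // mulrC.
have c1 := cos_le1 t.
move=> H; apply: (@le_trans _ _ ((h%:R + 1) * (cos t - cos t / h%:R))).
  by rewrite ler_wpM2l; lra.
rewrite (_ : _ * _ = cos t * (h%:R - h%:R^-1)); last first.
  by field; rewrite gt_eqF; lra.
have hi0 : 0 <= h%:R^-1 :> R by rewrite invr_ge0; lra.
have hi1 : h%:R^-1 <= 1 :> R by rewrite invf_le1; lra.
nra.
Qed.

(** The same factorisation for [t = w / (h + 1)], now expanding [cos (w - t)]; [sin t <= t] gives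
    [sin t / w <= 1 / (h + 1)]. *)
Lemma cos_profile_le (R : realType) (w : R) (h : nat) : 0 < w <= 1 ->
  cos w = w * sin w ->
  h%:R * cos (w / h.+1%:R * h%:R) <= h.+1%:R * cos (w / h.+1%:R * h.+1%:R).
Proof.
move=> /andP[w0 w1] wE.
have h0 : 0 <= h%:R :> R by [].
have cw : 0 < cos w by apply: cos_gt0_of_le1; rewrite ltW.
rewrite -natr1.
set t := w / (h%:R + 1).
have tw : t * (h%:R + 1) = w by rewrite /t divfK // gt_eqF; lra.
have t0 : 0 < t by rewrite divr_gt0 //; lra.
have ts := sin_le_id _ _ (ltW t0).
have sw : sin w = cos w / w by rewrite wE; field; rewrite gt_eqF.
rewrite tw (_ : t * h%:R = w - t); last by rewrite -tw; ring.
rewrite cosB sw (_ : cos w * cos t + _ = cos w * (cos t + sin t / w)); last by ring.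
rewrite mulrCA [leRHS]mulrC ler_pM2l //.
have : sin t / w <= (h%:R + 1)^-1.
  by rewrite ler_pdivrMr // -tw mulrC mulfK // gt_eqF; lra.
have c1 := cos_le1 t.
move=> H; apply: (@le_trans _ _ (h%:R * (1 + (h%:R + 1)^-1))).
  by rewrite ler_wpM2l; lra.
have hi1 : h%:R * (h%:R + 1)^-1 <= 1 :> R by rewrite ler_pdivrMr; lra.
lra.
Qed.

(** * Two-sided bounds on the number of rung sequences *)

Definition ladder_list (h n : nat) : seq (seq (int * int)) :=
  [seq (0, d) :: l | d <- ball_seq h, l <- ladder_paths h n (0, d)].

Lemma size_ladder_list (R : pzSemiRingType) (h n : nat) :
  (size (ladder_list h n))%:R =
  \sum_(d <- ball_seq h) (size (ladder_paths h n (0, d)))%:R :> R.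
Proof. by rewrite size_allpairs_dep sumnE big_map natr_sum. Qed.

Lemma sum_ball_seq_const (R : pzSemiRingType) (h : nat) (a : R) :
  \sum_(d <- ball_seq h) a = (2 * h).+1%:R * a.
Proof.
by rewrite big_const_seq count_predT size_ball_seq iter_addr_0 mulr_natl.
Qed.

Lemma cos_ge_on_ball (R : realType) (w t : R) (h : nat) (d : int) :
  0 <= t -> t * h%:R <= w -> w <= 1 -> `|d| <= h%:Z ->
  cos w <= cos (t * d%:~R).
Proof.
move=> t0 th w1 dh; have pi2 := pi_ge2 R.
rewrite -[cos (t * _)]cos_norm normrM (ger0_norm t0) -intr_norm.
have dhR : `|d|%:~R <= h%:R :> R by rewrite -[h%:R]/(h%:Z%:~R) ler_int.
have d0 : 0 <= `|d|%:~R :> R by rewrite ler0z.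
have td0 : 0 <= t * `|d|%:~R by rewrite mulr_ge0.
have tdw : t * `|d|%:~R <= w by apply: le_trans th; rewrite ler_wpM2l.
by rewrite leNgt ltr_cos ?in_itv /= -?leNgt; lra.
Qed.

(** The subsolution [cos (t d)], [t = w / h], lies between [cos w] and 1 on the ball. Each step
    gains a factor [1 / mu] with [mu = 1 - cos t <= t^2 / 2], hence the power [2n] of [h]; one more
    comes from the [2h + 1] initial rungs. *)
Lemma size_ladder_list_ge (R : realType) (w : R) (h n : nat) : 0 < w <= 1 ->
  cos w = w * sin w -> (0 < h)%N ->
  h%:R ^+ (2 * n).+1 * (cos w * (2 / w ^+ 2) ^+ n) <=
  (size (ladder_list h n))%:R.
Proof.
move=> wI wE h0; have /andP[w0 w1] := wI.
have hR : 0 < h%:R :> R by rewrite ltr0n.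
have cw : 0 < cos w by apply: cos_gt0_of_le1; rewrite ltW.
pose t := w / h%:R; have t0 : 0 < t by rewrite divr_gt0.
have th : t * h%:R = w by rewrite /t divfK // gt_eqF.
pose mu := 1 - cos t; pose v (d : int) := cos (t * d%:~R).
have mu0 : 0 <= mu by rewrite subr_ge0 cos_le1.
have muw : mu <= w ^+ 2 / 2 / h%:R ^+ 2.
  have := cos_ge_taylor2 _ _ (ltW t0); rewrite /mu.
  rewrite (_ : w ^+ 2 / 2 / h%:R ^+ 2 = t ^+ 2 / 2); first by lra.
  by rewrite /t; field; rewrite gt_eqF.
have vT d : `|d| <= h%:Z -> v d <= mu * transfer R h v d.
  move=> dh; rewrite transfer_cos // lerDl subr_ge0.
  exact: cos_profile_ge.
have N1 : h%:R * cos w <= mu ^+ n * (size (ladder_list h n))%:R.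
  apply: (@le_trans _ _ ((2 * h).+1%:R * cos w)).
    by rewrite ler_wpM2r ?ler_nat ?ltW //; lia.
  rewrite -sum_ball_seq_const size_ladder_list mulr_sumr.
  rewrite big_seq [leRHS]big_seq; apply: ler_sum => d; rewrite mem_ball_seq => dh.
  apply: (@le_trans _ _ (v (0 - d))).
    by apply: (@cos_ge_on_ball R w t h); rewrite ?sub0r ?normrN ?th // ltW.
  apply: (@size_ladder_paths_ge R h n v mu (0, d)) => //=.
    by move=> e _; exact: cos_le1.
  by rewrite sub0r normrN.
have N2 : h%:R * cos w <=
    (w ^+ 2 / 2 / h%:R ^+ 2) ^+ n * (size (ladder_list h n))%:R.
  apply: le_trans N1 _; rewrite ler_wpM2r // lerXn2r // nnegrE.
  exact: le_trans muw.
have k0 : 0 < h%:R ^+ (2 * n) * (2 / w ^+ 2) ^+ n.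
  by rewrite mulr_gt0 ?exprn_gt0 ?divr_gt0 ?exprn_gt0.
rewrite -(ler_pM2l k0) in N2.
have kk : h%:R ^+ (2 * n) * (2 / w ^+ 2) ^+ n *
    (w ^+ 2 / 2 / h%:R ^+ 2) ^+ n = 1.
  rewrite exprM -!exprMn (_ : _ * _ = 1) ?expr1n //.
  by field; rewrite !gt_eqF.
rewrite [leRHS]mulrA kk mul1r in N2; apply: le_trans N2.
rewrite (_ : h%:R ^+ (2 * n).+1 * _ = h%:R ^+ (2 * n) * (2 / w ^+ 2) ^+ n *
  (h%:R * cos w)) //.
by rewrite exprS; ring.
Qed.

Lemma pow_1Dinv_le (R : realType) (h n : nat) : (n <= h)%N -> (0 < h)%N ->
  (1 + h%:R^-1) ^+ n <= expR 1 :> R.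
Proof.
move=> nh h0; have hR : 0 < h%:R :> R by rewrite ltr0n.
apply: (@le_trans _ _ (expR h%:R^-1 ^+ n)).
  by rewrite lerXn2r ?nnegrE ?expR_ge0 ?expR_ge1Dx // addr_ge0 // invr_ge0 ltW.
by rewrite -expRM_natl ler_expR ler_pdivrMr // mul1r ler_nat.
Qed.

Lemma size_ladder_list_le (R : realType) (w : R) (h n : nat) : 0 < w <= 1 ->
  cos w = w * sin w -> (0 < h)%N -> (n <= h)%N ->
  (size (ladder_list h n))%:R <=
  h%:R ^+ (2 * n).+1 * (3 * expR 1 ^+ 3 / cos w * (2 / w ^+ 2) ^+ n).
Proof.
move=> wI wE h0 nh; have /andP[w0 w1] := wI.
have hR : 1 <= h%:R :> R by rewrite ler1n.
have cw : 0 < cos w by apply: cos_gt0_of_le1; rewrite ltW.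
pose t := w / h.+1%:R; have t0 : 0 < t by rewrite divr_gt0.
have th : t * h.+1%:R = w by rewrite /t divfK.
pose mu := 1 - cos t; pose v (d : int) := cos (t * d%:~R).
have mu0 : 0 <= mu by rewrite subr_ge0 cos_le1.
(* In the cube, two factors come from replacing [h + 1] by [h] in [t^2 / 2], and the third is a
   factor [h / (h + 1)] that absorbs the quartic Taylor term. Its [n]-th power is at most [e^3] when
   [n <= h], which is where the constant of the statement comes from. *)
pose q := w ^+ 2 / 2 / h%:R ^+ 2 / (1 + h%:R^-1) ^+ 3.
have muw : q <= mu.
  have := cos_le_taylor4 _ _ (ltW t0).
  have -> : q = t ^+ 2 / 2 * (h%:R / h.+1%:R).
    rewrite /q /t -natr1; field; rewrite !gt_eqF //; lra.
  have t1 : t <= h.+1%:R^-1 by rewrite /t ler_piMl // invr_ge0.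
  have i1 : h.+1%:R^-1 <= 1 :> R by rewrite invf_le1 // ler1n.
  have i0 : 0 < h.+1%:R^-1 :> R by rewrite invr_gt0.
  have -> : h%:R / h.+1%:R = 1 - h.+1%:R^-1 :> R.
    by rewrite -natr1; field; rewrite natr1.
  move: h.+1%:R^-1 t1 i1 i0 => i t1 i1 i0.
  have tt : t ^+ 2 <= i.
    rewrite expr2; apply: (le_trans _ t1); rewrite ler_piMr //; lra.
  have tt0 : 0 <= t ^+ 2 by rewrite exprn_ge0 // ltW.
  have -> : t ^+ 4 = (t ^+ 2) ^+ 2 by rewrite -exprM.
  rewrite /mu; move: (t ^+ 2) tt tt0 => s si s0.
  have := mulr_ge0 s0 (ltW i0); have : 0 <= s * (i - s) by rewrite mulr_ge0; lra.
  lra.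
have vT d : `|d| <= h%:Z -> mu * transfer R h v d <= v d.
  move=> dh; rewrite transfer_cos // gerDl subr_le0.
  exact: cos_profile_le.
have thw : t * h%:R <= w by rewrite -th ler_wpM2l ?ler_nat // ltW.
have N1 : cos w * mu ^+ n * (size (ladder_list h n))%:R <= 3 * h%:R.
  apply: (@le_trans _ _ ((2 * h).+1%:R * 1)).
    rewrite -sum_ball_seq_const size_ladder_list mulr_sumr.
    rewrite big_seq [leRHS]big_seq; apply: ler_sum => d; rewrite mem_ball_seq => dh.
    apply: (@le_trans _ _ (v (0 - d))); last exact: cos_le1.
    apply: (@size_ladder_paths_le R h n v mu (cos w) (0, d)) => //=.
      by move=> e eh; apply: (@cos_ge_on_ball R w t h); rewrite // ltW.
    by rewrite sub0r normrN.
  by rewrite mulr1 -natrM ler_nat; lia.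
have i0 : 0 <= h%:R^-1 :> R by rewrite invr_ge0; lra.
have q0 : 0 < q.
  by rewrite /q !divr_gt0 ?exprn_gt0 //; lra.
have N2 : cos w * q ^+ n * (size (ladder_list h n))%:R <= 3 * h%:R.
  apply: le_trans N1; rewrite ler_wpM2r // ler_wpM2l ?(ltW cw) //.
  by rewrite lerXn2r // nnegrE ltW.
have k0 : 0 < cos w * q ^+ n by rewrite mulr_gt0 // exprn_gt0.
rewrite -(ler_pM2l k0); apply: le_trans N2 _.
have -> : cos w * q ^+ n *
    (h%:R ^+ (2 * n).+1 * (3 * expR 1 ^+ 3 / cos w * (2 / w ^+ 2) ^+ n)) =
    3 * h%:R * expR 1 ^+ 3 * (q * h%:R ^+ 2 * (2 / w ^+ 2)) ^+ n.
  rewrite (exprMn n (q * h%:R ^+ 2)) (exprMn n q) (exprS _ (2 * n)) (exprM _ 2 n).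
  move: (q ^+ n) ((h%:R ^+ 2) ^+ n) ((2 / w ^+ 2) ^+ n) (expR 1 ^+ 3) => x y z u.
  by field; rewrite gt_eqF.
have -> : q * h%:R ^+ 2 * (2 / w ^+ 2) = ((1 + h%:R^-1) ^+ 3)^-1.
  by rewrite /q; field; rewrite !gt_eqF; lra.
rewrite -mulrA ler_peMr //.
rewrite exprVn -exprM mulnC exprM ler_pdivlMr ?exprn_gt0 ?mul1r //.
by rewrite lerXn2r ?nnegrE ?exprn_ge0 ?expR_ge0 ?pow_1Dinv_le //; lra.
Qed.

(** * Existence of the limit in h *)

(** A Fekete-type argument: rounding [m] up to a multiple of [h] gives [u m <= (m %/ h + 1) * u h],
    hence [v m <= v h + u h / m]. So [v] converges to its infimum over positive indices. *)
Lemma cvg_of_subhomogeneous (R : realType) (u : nat -> R) :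
  (forall h, 0 <= u h) -> {homo u : m n / (m <= n)%N >-> m <= n} ->
  (forall k h, (0 < k)%N -> u (k * h)%N <= k%:R * u h) ->
  let v := (fun h => h%:R^-1 * u h) in
  cvg (v @ \oo) /\ forall h, (0 < h)%N -> lim (v @ \oo) <= v h.
Proof.
move=> u0 umono usub v.
pose E := [set v h | h in [set h | (0 < h)%N]].
have v0 h : 0 <= v h by rewrite mulr_ge0 // invr_ge0.
have Elb : lbound E 0 by move=> _ [h _ <-].
have Einf : has_inf E by split; [exists (v 1%N), 1%N|exists 0].
have vL h : (0 < h)%N -> inf E <= v h.
  by move=> h0; apply: ge_inf; [exists 0|exists h].
have vdil m h : (0 < h)%N -> (0 < m)%N -> v m <= v h + m%:R^-1 * u h.
  move=> h0 m0; have hR : 0 < h%:R :> R by rewrite ltr0n.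
  have mR : 0 < m%:R :> R by rewrite ltr0n.
  have um : u m <= (m %/ h).+1%:R * u h.
    apply: le_trans (usub _ _ _) => //; apply: umono.
    by rewrite ltnW // ltn_ceil.
  have qm : (m %/ h)%:R <= m%:R / h%:R :> R.
    by rewrite ler_pdivlMr // -natrM ler_nat leq_trunc_div.
  rewrite /v -mulrDl -(ler_pM2l mR) mulVKf ?gt_eqF // mulrA mulrDr mulfV ?gt_eqF //.
  by apply: le_trans um _; rewrite ler_wpM2r // -natr1 lerD2r.
have vcvg : v @ \oo --> inf E.
  apply/cvgrPdist_le => e e0.
  have [_ [h h0 <-] vh] := inf_adherent (divr_gt0 e0 (ltr0Sn R 1)) Einf.
  near=> m.
  have m0 : (0 < m)%N by near: m; exact: nbhs_infty_gt.
  have mR : 0 < m%:R :> R by rewrite ltr0n.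
  have mu : m%:R^-1 * u h <= e / 2.
    rewrite mulrC ler_pdivrMr // -ler_pdivrMl ?divr_gt0 //.
    by near: m; exact: nbhs_infty_ger.
  rewrite distrC ger0_norm ?subr_ge0 ?vL //.
  have := vdil m h h0 m0; move: vh mu; lra.
split; first by apply/cvg_ex; exists (inf E).
by rewrite (cvg_lim _ vcvg).
Unshelve. all: by end_near. Qed.

(** Quotients differing by [h + 1] or more would force the numbers apart by at least
    [k (h + 1) - (k - 1) = k h + 1]. *)
Lemma divz_dist_le (k h : nat) (x y : int) : (0 < k)%N ->
  `|x - y| <= (k * h)%:Z -> `|(x %/ k)%Z - (y %/ k)%Z| <= h%:Z.
Proof.
move=> k0.
have kn : k%:Z != 0 by lia.
have kp : 0 < k%:Z by lia.
have := divz_eq x k; have := divz_eq y k.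
have := ltz_pmod x kp; have := ltz_pmod y kp.
have := modz_ge0 x kn; have := modz_ge0 y kn.
move: (x %/ k)%Z (y %/ k)%Z (x %% k)%Z (y %% k)%Z => q q' r r'.
move=> r'0 r0 r'k rk -> ->; rewrite PoszM !ler_norml => /andP[H1 H2].
by apply/andP; split; nia.
Qed.

Lemma subset_Lip (G : sgraph) (S : {set G}) (h h' : nat) : (h <= h')%N ->
  Lip S h `<=` Lip S h'.
Proof.
move=> hh f [f0 fL]; split=> // x y xy.
by apply: le_trans (fL _ _ xy) _; rewrite lez_nat.
Qed.

(* f is determined by its quotient and its remainder modulo k; the quotient is
   h-Lipschitz and the remainder is a k-valued function supported off S. *)
Lemma card_Lip_mul (G : sgraph) (S : {set G}) (k h : nat) :
  basepoints S -> (0 < k)%N ->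
  (#|` fset_set (Lip S (k * h))| <=
   k ^ (#|G| - #|components G|) * #|` fset_set (Lip S h)|)%N.
Proof.
(* A transversal has one vertex per component, so the exponent counts the vertices at which the
   remainder is free. *)
move=> bS k0; have -> : (#|G| - #|components G|)%N = #|~: S|.
  by rewrite -(card_transversal bS) -(cardsC S) addKn.
case: k k0 => // k _.
have kn : k.+1%:Z != 0 by [].
have kp : 0 < k.+1%:Z by [].
pose phi (f : {ffun G -> int}) : {ffun G -> 'I_k.+1} * {ffun G -> int} :=
  ([ffun x => inord (absz (f x %% k.+1%:Z)%Z)], [ffun x => (f x %/ k.+1%:Z)%Z]).
pose B := [seq (g, q) | g <- enum (pffun_on (ord0 : 'I_k.+1) (mem (~: S)) predT),
                        q <- enum_fset (fset_set (Lip S h))].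
have -> : (k.+1 ^ #|~: S| * #|` fset_set (Lip S h)|)%N = size B.
  by rewrite size_allpairs -cardE card_pffun_on card_ord.
rewrite -(size_map phi); apply: uniq_leq_size.
  rewrite map_inj_in_uniq ?fset_uniq // => f g _ _ [/ffunP E1 /ffunP E2].
  apply/ffunP => x; rewrite (divz_eq (f x) k.+1) (divz_eq (g x) k.+1).
  move: (E2 x) (E1 x); rewrite !ffunE => -> /(congr1 val) /=.
  rewrite !inordK; try by rewrite -ltz_nat gez0_abs ?modz_ge0 ?ltz_pmod.
  by move=> /(congr1 Posz); rewrite !gez0_abs ?modz_ge0 // => ->.
move=> _ /mapP[f + ->]; rewrite in_fset_set; last exact: finite_Lip.
rewrite inE => -[f0 fL]; apply: allpairs_f.
  rewrite mem_enum; apply/pffun_onP; split=> //.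
  apply/supportP => x; rewrite inE negbK => xS.
  by apply: val_inj; rewrite ffunE f0 // mod0z /= inordK.
rewrite in_fset_set; last exact: finite_Lip.
rewrite inE; split=> [r rS|x y xy]; rewrite !ffunE; first by rewrite f0 // div0z.
by apply: divz_dist_le => //; exact: fL.
Qed.

Definition lip_root (R : realType) (G : sgraph) (S : {set G}) (h : nat) : R :=
  (#|` fset_set (Lip S h)|)%:R `^ ((#|G| - #|components G|)%N%:R)^-1.

(** Taking the root of order [#|G| - #|components G|] turns the factor of [card_Lip_mul] into
    exactly [k], as subhomogeneity requires. *)
Lemma c_cvg_le (R : realType) (G : sgraph) (S : {set G}) : basepoints S ->
  (#|components G| < #|G|)%N ->
  cvg ((fun h : nat => h%:R^-1 * lip_root R G S h) @ \oo) /\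
  forall h, (0 < h)%N -> c R S <= h%:R^-1 * lip_root R G S h.
Proof.
move=> bS cG; pose d := (#|G| - #|components G|)%N.
have d0 : (0 < d)%N by rewrite subn_gt0.
have di0 : 0 <= d%:R^-1 :> R by rewrite invr_ge0.
apply: (@cvg_of_subhomogeneous R (lip_root R G S)) => [h|m n mn|k h k0].
- exact: powR_ge0.
- apply: ge0_ler_powR; rewrite ?nnegrE // ler_nat.
  by rewrite fsubset_leq_card // -fset_set_sub; try exact: finite_Lip; exact: subset_Lip.
- have -> : k%:R = (k ^ d)%:R `^ d%:R^-1 :> R.
    by rewrite natrX -powR_mulrn // -powRrM mulfV ?powRr1 // pnatr_eq0 -lt0n.
  rewrite -powRM //; apply: ge0_ler_powR; rewrite ?nnegrE -?natrM ?ler_nat //.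
  exact: card_Lip_mul.
Qed.

(** * Connectedness of grids and the reduction to rungs *)

Lemma components_connected (G : sgraph) (x0 : G) :
  (forall x y : G, connect (@adj G) x y) -> #|components G| = 1%N.
Proof.
move=> conn; apply/eqP/cards1P; exists [set: G]%SET.
apply/setP => A; rewrite finset.in_set1; apply/imsetP/eqP => [[x _ ->]|->].
  by apply/setP => y; rewrite !finset.inE conn.
exists x0; rewrite ?finset.inE //.
by apply/setP => y; rewrite !finset.inE conn.
Qed.

Lemma connect_path_graph (n : nat) (x y : path_graph n) :
  connect (@adj (path_graph n)) x y.
Proof.
have le_conn k : forall i j : 'I_n, (j : nat) = (i + k)%N ->
    connect (@adj (path_graph n)) i j.
  elim: k => [|k IH] i j ij.
    by have -> : i = j by [apply: val_inj; rewrite /= ij addn0]; exact: connect0.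
  have jn : (i + k < n)%N by have := ltn_ord j; rewrite ij addnS => /ltnW.
  apply: (connect_trans (IH i (Ordinal jn) erefl)); apply: connect1.
  by rewrite /= /path_adj /= ij addnS eqxx.
have [xy|yx] := leqP (x : 'I_n) (y : 'I_n).
  by apply: (le_conn (y - x)%N); rewrite subnKC.
rewrite (sym_connect_sym (@adj_sym (path_graph n))).
by apply: (le_conn (x - y)%N); rewrite subnKC // ltnW.
Qed.

Lemma connect_cart (G H : sgraph) :
  (forall x y : G, connect (@adj G) x y) ->
  (forall x y : H, connect (@adj H) x y) ->
  forall u v : cart G H, connect (@adj (cart G H)) u v.
Proof.
move=> cG cH [u1 u2] [v1 v2]; apply: (@connect_trans _ _ (u1, v2)).
  have /connectP[p pth ->] := cH u2 v2.
  elim: p u2 pth => [|z p IH] u2 /=; first by move=> _; exact: connect0.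
  move=> /andP[uz zp]; apply: connect_trans (IH _ zp); apply: connect1.
  by rewrite /= /cart_adj /= eqxx uz.
have /connectP[p pth ->] := cG u1 v1.
elim: p u1 pth => [|z p IH] u1 /=; first by move=> _; exact: connect0.
move=> /andP[uz zp]; apply: connect_trans (IH _ zp); apply: connect1.
by rewrite /= /cart_adj /= eqxx uz orbT.
Qed.

Lemma card_components_grid (m n : nat) :
  #|components (grid m.+1 n.+1)| = 1%N.
Proof.
apply: (@components_connected (grid m.+1 n.+1) (ord0, ord0)).
by apply: connect_cart => x y; exact: connect_path_graph.
Qed.

Lemma basepoints_grid (m n : nat) (S : {set grid m.+1 n.+1}) : basepoints S ->
  exists r, S = [set r]%SET.
Proof.
move=> bS; apply/cards1P; rewrite (card_transversal bS).
by rewrite card_components_grid.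
Qed.

Lemma path_map_iota (T : Type) (e : rel T) (g : nat -> T) (i n : nat) :
  path e (g i) [seq g j | j <- iota i.+1 n] =
  all (fun j => e (g j) (g j.+1)) (iota i n).
Proof. by elim: n i => [//|n IH] i /=; rewrite IH. Qed.

Definition ladder_fun (n : nat) (g : nat -> int * int) (x : grid 2 n) : int :=
  if x.1 == ord0 then (g x.2).1 else (g x.2).2.

(** [n] counts steps, so there are [n + 1] rungs. This indexed form mediates between [path] on lists
    and adjacency in the grid. *)
Definition ladder_ok (h n : nat) (g : nat -> int * int) : bool :=
  all (fun i => `|(g i).1 - (g i).2| <= h%:Z) (iota 0 n.+1) &&
  all (fun i => (`|(g i).1 - (g i.+1).1| <= h%:Z) &&
                (`|(g i).2 - (g i.+1).2| <= h%:Z)) (iota 0 n).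

Lemma ladder_okP (h n : nat) (g : nat -> int * int) :
  ladder_ok h n g <-> forall x y : grid 2 n.+1, adj x y ->
    `|ladder_fun _ g x - ladder_fun _ g y| <= h%:Z.
Proof.
rewrite /ladder_ok; split.
  move=> /andP[/allP rung /allP side].
  have step (k : 'I_2) (i j : 'I_n.+1) : i.+1 == j :> nat ->
      `|ladder_fun _ g (k, i) - ladder_fun _ g (k, j)| <= h%:Z.
    move=> /eqP ij; have iI : (i : nat) \in iota 0 n.
      by rewrite mem_iota; have := ltn_ord j; lia.
    have /andP[s1 s2] := side _ iI.
    by rewrite /ladder_fun /= -ij; case: ifP.
  have cross (k l : 'I_2) (i : 'I_n.+1) : k.+1 == l :> nat ->
      `|ladder_fun _ g (k, i) - ladder_fun _ g (l, i)| <= h%:Z.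
    move=> kl; have iI : (i : nat) \in iota 0 n.+1 by rewrite mem_iota ltn_ord.
    have [-> ->] : k = ord0 /\ l = lift ord0 ord0.
      by split; apply: val_inj => /=; have := ltn_ord l; rewrite /bump /=; lia.
    by rewrite /ladder_fun /=; exact: rung.
  move=> [k i] [l j] /=; rewrite /cart_adj /= /path_adj.
  case/orP => [/andP[/eqP <- e]|/andP[e /eqP <-]]; case/orP: e => e.
  - exact: step.
  - by rewrite distrC; exact: step.
  - exact: cross.
  - by rewrite distrC; exact: cross.
move=> L; apply/andP; split; apply/allP => i; rewrite mem_iota add0n => /= iN.
  have := L (ord0, inord i) (lift ord0 ord0, inord i).
  by rewrite /ladder_fun /= inordK //; apply; rewrite /cart_adj /= /path_adj /= eqxx.
have iN1 : (i < n.+1)%N by lia.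
have jN1 : (i.+1 < n.+1)%N by lia.
have adjk k : adj ((k, inord i) : grid 2 n.+1) (k, inord i.+1).
  by rewrite /= /cart_adj /= /path_adj !inordK // !eqxx.
have := L _ _ (adjk ord0); have := L _ _ (adjk (lift ord0 ord0)).
by rewrite /ladder_fun /= !inordK // => -> ->.
Qed.

Lemma mem_ladder_list (h n : nat) (l : seq (int * int)) :
  (l \in ladder_list h n) =
  [&& size l == n.+1, (nth (0, 0) l 0).1 == 0 & ladder_ok h n (nth (0, 0) l)].
Proof.
case: l => [|[a b] l].
  by apply/negbTE/allpairsPdep => -[d [l []]].
pose g := nth (0, 0) ((a, b) :: l).
have gl : size l = n -> l = [seq g j | j <- iota 1 n].
  move=> <-; rewrite -[X in iota X _]addn0 iotaDl -map_comp.
  by rewrite -[LHS](mkseq_nth (0, 0)).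
have okE : size l = n -> ladder_ok h n g =
    (`|a - b| <= h%:Z) && path (ladder_step h) (a, b) l.
  move=> /gl ->; rewrite -[(a, b)]/(g 0%N) path_map_iota /ladder_ok /=.
  rewrite -andbA; congr (_ && _).
  rewrite -[X in iota X _]addn0 iotaDl all_map -all_predI.
  by apply: eq_all => i /=; rewrite andbC -andbA.
apply/allpairsPdep/and3P => /= [[d [l' []]]|[]].
  rewrite mem_ball_seq mem_ladder_paths => dh /andP[/eqP sl pl] [aE bE lE].
  rewrite -lE in sl pl; rewrite sl okE // aE bE pl sub0r normrN dh.
  by rewrite !eqxx.
rewrite eqSS => /eqP sl /eqP a0; rewrite okE // a0 sub0r normrN => /andP[bh pl].
by exists b, l; rewrite mem_ball_seq mem_ladder_paths sl eqxx.
Qed.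

(* Translating a function so that it vanishes at the corner (0, 0) makes the
   count independent of the base point. *)
Lemma card_Lip_grid (n h : nat) (S : {set grid 2 n.+1}) : basepoints S ->
  #|` fset_set (Lip S h)| = size (ladder_list h n).
Proof.
move=> bS; have fL := finite_Lip h bS.
have [r Sr] := basepoints_grid _ _ _ bS.
pose o : grid 2 n.+1 := (ord0, ord0).
pose phi (f : {ffun grid 2 n.+1 -> int}) : seq (int * int) :=
  mkseq (fun i => (f (ord0, inord i) - f o, f (ord_max, inord i) - f o)) n.+1.
have phiE f x : ladder_fun _ (nth (0, 0) (phi f)) x = f x - f o.
  case: x => k i; rewrite /ladder_fun /phi /= nth_mkseq // inord_val.
  have [-> //|k0] := eqVneq k ord0.
  have -> // : k = ord_max.
  by apply: val_inj; move: k0; rewrite -val_eqE /=; have := ltn_ord k; lia.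
rewrite -(size_map phi); apply: perm_size; apply: uniq_perm.
- rewrite map_inj_in_uniq ?fset_uniq // => f f'.
  rewrite !in_fset_set // !inE => -[f0 _] [f'0 _] ff'.
  have fx x : f x - f o = f' x - f' o by rewrite -!phiE ff'.
  have rS : r \in S by rewrite Sr finset.inE.
  (* Both functions vanish at the base point [r], so equal translates force equal values at the
     corner, and then everywhere. *)
  have := fx r; rewrite f0 // f'0 // !sub0r => /oppr_inj foE.
  by apply/ffunP => x; have := fx x; rewrite foE => /addIr.
- apply: allpairs_uniq_dep; first exact: uniq_ball_seq.
    by move=> d _; exact: uniq_ladder_paths.
  by move=> [d l] [d' l'] _ _ /= [-> ->].
move=> l; rewrite mem_ladder_list; apply/mapP/and3P => [[f + ->]|[sl l0 lok]].
  rewrite in_fset_set // inE => -[_ fLip].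
  split; first by rewrite size_mkseq.
    by rewrite /phi /= (_ : inord 0 = ord0) ?subrr //; apply: val_inj; rewrite /= inordK.
  apply/ladder_okP => x y xy; rewrite !phiE opprB addrA subrK.
  exact: fLip.
pose F := ladder_fun n.+1 (nth (0, 0) l).
(* The preimage is the ladder function translated back to vanish at [r]. *)
exists [ffun x => F x - F r].
  rewrite in_fset_set // inE; split=> [x|x y xy].
    by rewrite Sr finset.inE ffunE => /eqP ->; rewrite subrr.
  by rewrite !ffunE opprB addrA subrK; move/ladder_okP: lok; apply.
have Fo : F o = 0 by rewrite /F /ladder_fun /=; exact/eqP.
apply: (@eq_from_nth _ (0, 0)); rewrite ?size_mkseq; first exact/eqP.
rewrite (eqP sl) => i iN; rewrite nth_mkseq // !ffunE Fo sub0r !opprK !subrK.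
by rewrite /F /ladder_fun /= inordK //; case: (nth _ _ _).
Qed.

(** * The limit in n *)

Lemma card_grid (m n : nat) : #|grid m n| = (m * n)%N.
Proof. by rewrite card_prod !card_ord. Qed.

Lemma scaled_root (R : realType) (h d : nat) (x : R) : (0 < h)%N -> (0 < d)%N ->
  0 <= x -> h%:R^-1 * (h%:R ^+ d * x) `^ d%:R^-1 = x `^ d%:R^-1.
Proof.
move=> h0 d0 x0; rewrite powRM ?exprn_ge0 // -powR_mulrn // -powRrM.
by rewrite mulfV ?pnatr_eq0 -?lt0n // powRr1 // mulKf // pnatr_eq0 -lt0n.
Qed.

Lemma c_grid_bounds (R : realType) (w : R) (n : nat)
    (S : {set grid 2 n.+1}) : 0 < w <= 1 -> cos w = w * sin w -> basepoints S ->
  (cos w * (2 / w ^+ 2) ^+ n) `^ ((2 * n).+1%:R)^-1 <= c R S <=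
  (3 * expR 1 ^+ 3 / cos w * (2 / w ^+ 2) ^+ n) `^ ((2 * n).+1%:R)^-1.
Proof.
move=> wI wE bS; have /andP[w0 w1] := wI.
have cw : 0 < cos w by apply: cos_gt0_of_le1; rewrite ltW.
have dE : (#|grid 2 n.+1| - #|components (grid 2 n.+1)|)%N = (2 * n).+1.
  by rewrite card_grid card_components_grid; lia.
have [|cv cle] := @c_cvg_le R _ S bS.
  by rewrite card_grid card_components_grid; lia.
have rootE h : lip_root R (grid 2 n.+1) S h =
    (size (ladder_list h n))%:R `^ ((2 * n).+1%:R)^-1.
  by rewrite /lip_root dE card_Lip_grid.
have e0 : 0 <= ((2 * n).+1%:R)^-1 :> R by rewrite invr_ge0.
have k0 : 0 <= (2 / w ^+ 2) ^+ n by rewrite exprn_ge0 // divr_ge0 // exprn_ge0 // ltW.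
apply/andP; split.
  apply: limr_ge => //; near=> h.
  have h0 : (0 < h)%N by near: h; exact: nbhs_infty_gt.
  rewrite -[leRHS]/(h%:R^-1 * lip_root R (grid 2 n.+1) S h) rootE.
  rewrite -[leLHS](@scaled_root R h) //; last by rewrite mulr_ge0 // ltW.
  rewrite ler_wpM2l ?invr_ge0 //; apply: ge0_ler_powR; rewrite ?nnegrE //.
    by rewrite mulr_ge0 ?exprn_ge0 // mulr_ge0 // ltW.
  exact: size_ladder_list_ge.
(* The upper count is only available for [n <= h], but [c] lies below every term of its sequence
   with positive index, so the single value [h = n + 1] suffices. The lower count holds for all
   positive [h] and passed to the limit above. *)
apply: le_trans (cle n.+1 _) _ => //; rewrite rootE.
have C0 : 0 <= 3 * expR 1 ^+ 3 / cos w * (2 / w ^+ 2) ^+ n.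
  by rewrite mulr_ge0 // divr_ge0 ?ltW // mulr_gt0 // exprn_gt0 // expR_gt0.
rewrite -[leRHS](@scaled_root R n.+1) //.
rewrite ler_wpM2l ?invr_ge0 //; apply: ge0_ler_powR; rewrite ?nnegrE //.
  by rewrite mulr_ge0 ?exprn_ge0.
exact: size_ladder_list_le.
Unshelve. all: by end_near. Qed.

(** The logarithm of the term is [ln k / 2 + (ln C - ln k / 2) / (2n + 1)], so the constant [C]
    disappears in the limit. This is why bounds up to constant factors determine the limit of
    [c]. *)
Lemma cvg_root_geometric (R : realType) (C k : R) : 0 < C -> 0 < k ->
  (fun n : nat => (C * k ^+ n) `^ ((2 * n).+1%:R)^-1) @ \oo --> Num.sqrt k.
Proof.
move=> C0 k0.
pose e (n : nat) : R := ((2 * n).+1%:R)^-1.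
have e0 : e @ \oo --> 0.
  apply/cvgrPdist_le => d d0; near=> n.
  have n0 : (0 < n)%N by near: n; exact: nbhs_infty_gt.
  rewrite sub0r normrN ger0_norm ?invr_ge0 //.
  apply: (@le_trans _ _ (n%:R^-1)).
    by rewrite lef_pV2 ?posrE ?ltr0n // ler_nat; lia.
  rewrite -[d]invrK lef_pV2 ?posrE ?ltr0n ?invr_gt0 //.
  by near: n; exact: nbhs_infty_ger.
have -> : (fun n : nat => (C * k ^+ n) `^ ((2 * n).+1%:R)^-1) =
    (fun n => expR (ln k / 2 + e n * (ln C - ln k / 2))).
  apply/funext => n; rewrite -[C * _]lnK ?posrE ?mulr_gt0 ?exprn_gt0 //.
  rewrite -expRM; congr expR.
  rewrite lnM ?posrE ?exprn_gt0 // lnXn // /e -mulr_natl -natr1 natrM.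
  by field; rewrite gt_eqF //.
have -> : Num.sqrt k = expR (ln k / 2 + 0 * (ln C - ln k / 2)).
  by rewrite mul0r addr0 -powR12_sqrt ?ltW // /powR gt_eqF // mulrC.
apply: continuous_cvg; first exact: continuous_expR.
apply: cvgD; first exact: cvg_cst.
exact: cvgMl.
Unshelve. all: by end_near. Qed.

Theorem theorem2p2p1 (R : realType) (S : forall n : nat, {set grid 2 n})
    (hS : forall n : nat, basepoints (S n)) :
  exists alpha : R,
    [/\ largest_tan_inv_solution alpha,
        (fun n : nat => c R (S n)) @ \oo --> alpha * Num.sqrt 2 &
        16437 / 10 ^+ 4 <= alpha * Num.sqrt 2 < 16438 / 10 ^+ 4].
Proof.
have [w [wb wE]] := exists_cos_eq_id_sin R.
have wI : 0 < w <= 1 by lra.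
have /andP[w0 w1] := wI.
have cw : 0 < cos w by apply: cos_gt0_of_le1; rewrite ltW.
have k0 : 0 < 2 / w ^+ 2 by rewrite divr_gt0 // exprn_gt0.
exists w^-1; split.
- exact: largest_tan_inv_solution_inv.
- have -> : w^-1 * Num.sqrt 2 = Num.sqrt (2 / w ^+ 2).
    by rewrite sqrtrM // sqrtrV ?exprn_ge0 ?ltW // sqrtr_sqr gtr0_norm // mulrC.
  (* The shift discards the empty grid at [n = 0]; the bounds concern [grid 2 n.+1]. *)
  rewrite -(cvg_shiftS (fun n => c R (S n))).
  apply: squeeze_cvgr; first by apply: nearW => n; exact: (c_grid_bounds R w).
    exact: cvg_root_geometric.
  apply: cvg_root_geometric => //.
  by rewrite divr_gt0 // mulr_gt0 // exprn_gt0 // expR_gt0.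
- exact: inv_mul_sqrt2_bounds.
Qed.
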